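(* For all positive integers $g,d$ there is an integer $\hat n_{g,d}$ such that the following holds for every symmetric nc polynomial $p$ of degree $d$ in $g$ symmetric variables which is a ($0$-)minimum degree defining polynomial for $\mathcal V(p)$ (the integer $\hat n_{g,d}$ not depending on $p$): for every $n\ge\hat n_{g,d}$ there exists a pair $(X,v)\in(\mathbb R^{n\times n}_{sym})^g\times\mathbb R^n$ in $\mathcal V(p)$ such that $$C_\pm(\mathcal V(p))=\left\lceil\frac{c^n_\pm(X,v;p)}{n}\right\rceil,$$ where $\lceil r\rceil$ is the smallest integer greater than or equal to the real number $r$.
   Context: Nc polynomials: $x=(x_1,\dots,x_g)$ are noncommuting indeterminates and $\mathbb R\langle x\rangle$ is the set of finite real linear combinations of words in $x$ (including the empty word); the degree is the maximal length of a word appearing nontrivially. The involution $T$ reverses words, with $x_j^T=x_j$ (the variables are ''symmetric''), and is extended linearly; $p$ is symmetric if $p^T=p$. For $X=(X_1,\dots,X_g)\in(\mathbb R^{n\times n}_{sym})^g$ (a $g$-tuple of real symmetric $n\times n$ matrices), $p(X)$ is the $n\times n$ matrix obtained by substitution, the constant term $c$ becoming $cI_n$. Derivatives: $p'(X)[H]=\frac{d}{dt}\big|_{t=0}p(X+tH)$ and $p''(X)[H]=\frac{d^2}{dt^2}\big|_{t=0}p(X+tH)$ for $X,H\in(\mathbb R^{n\times n}_{sym})^g$. Variety: $\mathcal V(p)=\bigcup_{n\ge1}\mathcal V_n(p)$, $\mathcal V_n(p)=\{(X,v)\in(\mathbb R^{n\times n}_{sym})^g\times\mathbb R^n: p(X)v=0\}$.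 Signature: for $(X,v)\in(\mathbb R^{n\times n}_{sym})^g\times\mathbb R^n$, $c^n_+(X,v;p)$ (resp. $c^n_-(X,v;p)$) is the maximum dimension of a subspace of $\{H\in(\mathbb R^{n\times n}_{sym})^g:p'(X)[H]v=0\}$ on which $\langle p''(X)[H]v,v\rangle>0$ (resp. $<0$) for all nonzero $H$. The signature of the curvature of $\mathcal V(p)$ is $$C_\pm(\mathcal V(p))=\lim_{n\to\infty}\ \sup\left\{\frac{c^n_\pm(X,v;p)}{n}:(X,v)\in\mathcal V_n(p)\right\},$$ a limit that exists. Statements with $\pm$ are asserted for each sign. Minimum degree defining polynomial: $p$ is a ($0$-)minimum degree defining polynomial for $\mathcal V(p)$ if every nonzero (not necessarily symmetric) nc polynomial $q$ with $q(X)v=0$ for all $(X,v)\in\mathcal V(p)$ satisfies $\deg q\ge\deg p$. *)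

(* Defs.v *)
From mathcomp Require Import all_boot all_order all_algebra.
From mathcomp Require Import finmap.
From mathcomp Require Import all_classical all_reals all_analysis.
(* The notations of monalg cannot be loaded together with those of
   mathcomp-analysis, hence the prefix forms malg, fmonom, mcoeff, mkmalgU. *)
From mathcomp.multinomials Require Export -(notations) monalg.

Set Implicit Arguments.
Unset Strict Implicit.
Unset Printing Implicit Defensive.

Import Order.TTheory GRing.Theory Num.Theory.
Import numFieldNormedType.Exports.

Local Open Scope classical_set_scope.
Local Open Scope ring_scope.

(* The free algebra R<x_0, .., x_(g-1)>: the monoid algebra of the free monoid
   of words over 'I_g. *)
Notation ncpoly R g := (malg (fmonom 'I_g) R).

Notation mxtuple R g n := {ffun 'I_g -> 'M[R]_n}.

(* As usual for a nat-valued degree, ncdeg 0 = 0. *)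
Definition ncdeg (R : realType) (g : nat) (p : ncpoly R g) : nat :=
  \max_(w <- msupp p) fdeg w.

Definition nctr (R : realType) (g : nat) (p : ncpoly R g) : ncpoly R g :=
  \sum_(w <- msupp p) mkmalgU (FMonom (rev w)) (mcoeff w p).

Definition ncsymmetric (R : realType) (g : nat) (p : ncpoly R g) : Prop :=
  nctr p = p.

Definition nceval (R : realType) (g n : nat) (p : ncpoly R g)
    (X : mxtuple R g n) : 'M[R]_n :=
  \sum_(w <- msupp p) mcoeff w p *: \prod_(j <- (w : seq 'I_g)) X j.

Definition symtuple (R : realType) (g n : nat) (X : mxtuple R g n) : Prop :=
  forall j, (X j)^T = X j.

Definition ncderiv (R : realType) (g n : nat) (p : ncpoly R g)
    (X H : mxtuple R g n) : 'M[R]_n :=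
  derive1 (fun t : R => nceval p (X + t *: H)) 0.

Definition nchess (R : realType) (g n : nat) (p : ncpoly R g)
    (X H : mxtuple R g n) : 'M[R]_n :=
  derive1n 2 (fun t : R => nceval p (X + t *: H)) 0.

Definition in_variety (R : realType) (g n : nat) (p : ncpoly R g)
    (X : mxtuple R g n) (v : 'cV[R]_n) : Prop :=
  symtuple X /\ nceval p X *m v = 0.

Definition dotv (R : realType) (n : nat) (u v : 'cV[R]_n) : R :=
  (u^T *m v) 0 0.

(* The sign: false stands for + and true for -. *)
Definition definite_on (R : realType) (g n : nat) (s : bool) (p : ncpoly R g)
    (X : mxtuple R g n) (v : 'cV[R]_n) (U : {vspace mxtuple R g n}) : Prop :=
  (forall H, H \in U -> symtuple H /\ ncderiv p X H *m v = 0) /\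
  (forall H, H \in U -> H != 0 -> 0 < (-1) ^+ s * dotv (nchess p X H *m v) v).

(* c^n_+ and c^n_-; the maximum is over a nonempty set, as U = 0 qualifies. *)
Definition curv_dim (R : realType) (g n : nat) (s : bool) (p : ncpoly R g)
    (X : mxtuple R g n) (v : 'cV[R]_n) : nat :=
  \max_(k < (\dim {: mxtuple R g n}).+1 |
        `[< exists2 U : {vspace mxtuple R g n},
              \dim U = k & definite_on s p X v U >]) k.

(* For 0 < n the set is nonempty (take v = 0) and bounded. *)
Definition curv_sup (R : realType) (g : nat) (s : bool) (p : ncpoly R g)
    (n : nat) : R :=
  sup [set r : R | exists (X : mxtuple R g n) (v : 'cV[R]_n),
         in_variety p X v /\ r = (curv_dim s p X v)%:R / n%:R].

Definition curvature_signature (R : realType) (g : nat) (s : bool)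
    (p : ncpoly R g) : R :=
  limn (curv_sup s p).

Definition min_degree_defining (R : realType) (g : nat) (p : ncpoly R g)
    : Prop :=
  forall q : ncpoly R g, q != 0 ->
    (forall (n : nat) (X : mxtuple R g n) (v : 'cV[R]_n), (0 < n)%N ->
       in_variety p X v -> nceval q X *m v = 0) ->
    (ncdeg p <= ncdeg q)%N.

(* Main.v *)
(* Write u_{jb} = H_j b(X) v for the border vector. Then <p''(X)[H] v, v> is a
   quadratic form in u whose matrix is polynomial in X, and the substitution
   u_w |-> sum_i al_i (take i w)(X) u_{drop i w}, where (al_i) are the Taylor
   coefficients of (1 - t)^(-1/2), turns it into n copies of a scalar quadratic
   form q depending only on p. Let m be the maximal dimension of a subspace on
   which q is positive (negative for the other sign); then c^n(X, v; p) <= n m for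
   all (X, v) in V(p). The constraint p'(X)[H] v = 0 costs nothing: it can be
   solved for a component u_w with |w| = deg p, which q does not see.
   Conversely, when the vectors b(X) v with |b| < deg p are linearly
   independent, the border vectors of symmetric H fill a subspace whose
   codimension K depends only on g and d, so c^n(X, v; p) >= n m - K. Such pairs
   exist in V(p) for every n at least the number of words of length < deg p: by
   minimality of the degree, a direct sum of pairs in V(p) separates all
   polynomials of degree < deg p; it can be compressed to the span of the
   b(X) v, and then padded with zeros. Hence the limit is m, which is also the
   ceiling of c^n / n as soon as n > K. *)
Require Import Defs.
From HB Require Import structures.
From mathcomp Require Import all_boot all_order all_algebra.
From mathcomp Require Import all_classical all_reals all_analysis.
From mathcomp Require Import finmap ring zify.

Set Implicit Arguments.
Unset Strict Implicit.
Unset Printing Implicit Defensive.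

Import Order.TTheory GRing.Theory Num.Theory.
Import numFieldNormedType.Exports.

Local Open Scope ring_scope.

(** * Derivatives of matrix-valued polynomials in one real variable *)

Lemma derive1_poly (R : realType) (n K : nat) (C : nat -> 'M[R]_n) :
  derive1 (fun t : R => \sum_(k < K) t ^+ k *: C k) =
  (fun t : R => \sum_(k < K) (k%:R * t ^+ k.-1) *: C k).
Proof.
apply/funext => t; rewrite derive1E.
have dX (k : nat) : differentiable (fun t : R => t ^+ k) t.
  by apply/derivable1_diffP; apply: exprn_derivable.
have dC (k : 'I_K) :
    is_derive t 1 (fun t : R => t ^+ k *: C k) ((k%:R * t ^+ k.-1) *: C k).
  apply: DeriveDef; first exact/diff_derivable/differentiableZl.
  rewrite deriveE ?diffZl //=; last exact: differentiableZl.
  by rewrite -deriveE // exp_derive [_ *: 1]mulr1.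
rewrite [X in 'D_1 X t](_ : _ = \sum_(k < K) (fun t : R => t ^+ k *: C k)).
  exact: derive_val.
by apply/funext => x; rewrite fct_sumE.
Qed.

Lemma derive1_poly0 (R : realType) (n K : nat) (C : nat -> 'M[R]_n) :
  (1 < K)%N -> derive1 (fun t : R => \sum_(k < K) t ^+ k *: C k) 0 = C 1%N.
Proof.
case: K => [|[|K]] // _; rewrite derive1_poly.
rewrite big_ord_recl mul0r scale0r add0r big_ord_recl /= mulr1 scale1r big1 ?addr0//.
by move=> i _; rewrite /= expr0n /= mulr0 scale0r.
Qed.

Lemma derive2_poly0 (R : realType) (n K : nat) (C : nat -> 'M[R]_n) :
  (2 < K)%N ->
  derive1n 2 (fun t : R => \sum_(k < K) t ^+ k *: C k) 0 = 2 *: C 2%N.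
Proof.
case: K => [|K] // K2; rewrite /derive1n /= derive1_poly.
rewrite [X in derive1 X](_ : _ =
  fun t : R => \sum_(k < K) t ^+ k *: (k.+1%:R *: C k.+1)).
  by rewrite (derive1_poly0 (fun k => k.+1%:R *: C k.+1)).
apply/funext => t; rewrite big_ord_recl mul0r scale0r add0r.
by apply: eq_bigr => i _; rewrite /= scalerA mulrC.
Qed.

(** * The dot product *)

Section DotProduct.
Variables (R : realType) (n : nat).
Implicit Types u v : 'cV[R]_n.

Lemma dotvE u v : dotv u v = \sum_i u i 0 * v i 0.
Proof. by rewrite /dotv mxE; apply: eq_bigr => i _; rewrite mxE. Qed.

Lemma dotvC u v : dotv u v = dotv v u.
Proof. by rewrite !dotvE; apply: eq_bigr => i _; rewrite mulrC. Qed.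

Lemma dotv_suml (I : Type) (r : seq I) (P : pred I) (F : I -> 'cV[R]_n) v :
  dotv (\sum_(i <- r | P i) F i) v = \sum_(i <- r | P i) dotv (F i) v.
Proof. by rewrite /dotv linear_sum mulmx_suml summxE. Qed.

Lemma dotv_sumr (I : Type) (r : seq I) (P : pred I) (F : I -> 'cV[R]_n) v :
  dotv v (\sum_(i <- r | P i) F i) = \sum_(i <- r | P i) dotv v (F i).
Proof. by rewrite dotvC dotv_suml; apply: eq_bigr => i _; rewrite dotvC. Qed.

Lemma dotvZl (a : R) u v : dotv (a *: u) v = a * dotv u v.
Proof. by rewrite /dotv linearZ /= -scalemxAl mxE. Qed.

Lemma dotvZr (a : R) u v : dotv u (a *: v) = a * dotv u v.
Proof. by rewrite dotvC dotvZl dotvC. Qed.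

Lemma dotv_mull (A : 'M[R]_n) u v : dotv (A *m u) v = dotv u (A^T *m v).
Proof. by rewrite /dotv trmx_mul mulmxA. Qed.

End DotProduct.

Lemma size_le_ncdeg (R : realType) (g : nat) (p : ncpoly R g) w :
  w \in msupp p -> (size w <= ncdeg p)%N.
Proof. by move=> wp; apply: (leq_bigmax_seq (F := fun w => fdeg w) w). Qed.

(** * Words evaluated along the line [X + t *: H] *)

Section Words.
Variables (R : realType) (g n : nat).
Implicit Types (X H : mxtuple R g n) (w : seq 'I_g) (v : 'cV[R]_n).

Definition evw X w : 'M[R]_n := \prod_(j <- w) X j.

Lemma evw_nil X : evw X [::] = 1%:M.
Proof. by rewrite /evw big_nil. Qed.

Lemma evw_cons X j w : evw X (j :: w) = X j *m evw X w.
Proof. by rewrite /evw big_cons. Qed.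

Lemma evw_cat X w w' : evw X (w ++ w') = evw X w *m evw X w'.
Proof. by rewrite /evw big_cat. Qed.

Lemma tr_evw X w : symtuple X -> (evw X w)^T = evw X (rev w).
Proof.
move=> sX; elim: w => [|j w IHw]; first by rewrite evw_nil trmx1.
by rewrite evw_cons trmx_mul IHw sX rev_cons -cats1 evw_cat /evw big_seq1.
Qed.

Lemma ncevalE (p : ncpoly R g) X :
  nceval p X = \sum_(w <- msupp p) mcoeff w p *: evw X w.
Proof. by []. Qed.

(** The coefficient of [t ^+ k] in [w] evaluated at [X + t *: H]: each letter [j] contributes [X j],
    or [H j] at the cost of one power of [t]. *)
Fixpoint shift_coef X H w (k : nat) : 'M[R]_n :=
  match w with
  | [::] => if k == 0%N then 1%:M else 0
  | j :: w' => X j *m shift_coef X H w' k +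
      (if k is k'.+1 then H j *m shift_coef X H w' k' else 0)
  end.

Lemma evw_shift X H w K (t : R) : (size w < K)%N ->
  evw (X + t *: H) w = \sum_(k < K) t ^+ k *: shift_coef X H w k.
Proof.
elim: w K => [|j w IHw] [|K] // wK.
  rewrite evw_nil big_ord_recl expr0 scale1r big1 ?addr0 //= => i _.
  by rewrite scaler0.
rewrite evw_cons !ffunE mulmxDl {1}(IHw K.+1) ?(ltnW wK) // (IHw K) //.
under [RHS]eq_bigr do rewrite /= scalerDr.
rewrite big_split /=; congr (_ + _).
  by rewrite mulmx_sumr; apply: eq_bigr => i _; rewrite scalemxAr.
rewrite big_ord_recl /= scaler0 add0r mulmx_sumr.
by apply: eq_bigr => i _; rewrite /= -scalemxAl -scalemxAr scalerA exprS.
Qed.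

Lemma shift_coef0 X H w : shift_coef X H w 0 = evw X w.
Proof.
elim: w => [|j w IHw] /=; first by rewrite evw_nil.
by rewrite IHw addr0 evw_cons.
Qed.

(** The bound [(ncdeg p).+3] serves all words of [p] and exceeds 2, so that both derivatives can be
    read off even in low degree. *)
Lemma nceval_shift (p : ncpoly R g) X H (t : R) :
  nceval p (X + t *: H) = \sum_(k < (ncdeg p).+3)
    t ^+ k *: (\sum_(w <- msupp p) mcoeff w p *: shift_coef X H w k).
Proof.
rewrite ncevalE.
transitivity (\sum_(w <- msupp p) \sum_(k < (ncdeg p).+3)
    t ^+ k *: (mcoeff w p *: shift_coef X H w k)).
  apply: eq_big_seq => w wp; rewrite (@evw_shift _ _ _ (ncdeg p).+3).
    by rewrite scaler_sumr; apply: eq_bigr => k _; rewrite !scalerA mulrC.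
  by apply: (@leq_trans (ncdeg p).+1); [exact: size_le_ncdeg wp | lia].
by rewrite exchange_big; apply: eq_bigr => k _; rewrite scaler_sumr.
Qed.

Lemma ncderivE (p : ncpoly R g) X H :
  ncderiv p X H = \sum_(w <- msupp p) mcoeff w p *: shift_coef X H w 1.
Proof.
rewrite /ncderiv; under eq_fun do rewrite nceval_shift.
exact: (derive1_poly0 (fun k =>
  \sum_(w <- msupp p) mcoeff w p *: shift_coef X H w k)).
Qed.

Lemma nchessE (p : ncpoly R g) X H :
  nchess p X H = 2 *: \sum_(w <- msupp p) mcoeff w p *: shift_coef X H w 2.
Proof.
rewrite /nchess; under eq_fun do rewrite nceval_shift.
exact: (derive2_poly0 (fun k =>
  \sum_(w <- msupp p) mcoeff w p *: shift_coef X H w k)).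
Qed.

(* The border vector of the Hessian; the empty word is only padding. *)
Definition border X H v w : 'cV[R]_n :=
  if w is j :: b then H j *m (evw X b *m v) else 0.

Lemma shift_coef1 X H v w :
  shift_coef X H w 1 *m v =
  \sum_(i < size w) evw X (take i w) *m border X H v (drop i w).
Proof.
elim: w => [|j w IHw] /=; first by rewrite mul0mx big_ord0.
rewrite big_ord_recl /= evw_nil mul1mx mulmxDl shift_coef0 -!mulmxA IHw addrC.
congr (_ + _); rewrite mulmx_sumr.
by apply: eq_bigr => i _; rewrite evw_cons mulmxA.
Qed.

Lemma shift_coef2 X H v w :
  shift_coef X H w 2 *m v =
  \sum_(i < size w) evw X (take i w) *m
    (if drop i w is j :: b then H j *m (shift_coef X H b 1 *m v) else 0).
Proof.
elim: w => [|j w IHw] /=; first by rewrite mul0mx big_ord0.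
rewrite big_ord_recl /= evw_nil mul1mx mulmxDl -!mulmxA IHw addrC.
congr (_ + _); rewrite mulmx_sumr.
by apply: eq_bigr => i _; rewrite evw_cons mulmxA.
Qed.

(** The two occurrences of [H] sit at positions [a - 1] and [b]. Symmetry moves the prefix ending
    with the first one across the dot product, reversed; the letters in between stay in the
    middle. *)
Lemma dotv_shift_coef2 X H v w : symtuple X -> symtuple H ->
  dotv (shift_coef X H w 2 *m v) v =
  \sum_(1 <= a < size w) \sum_(a <= b < size w)
    dotv (border X H v (rev (take a w)))
      (evw X (drop a (take b w)) *m border X H v (drop b w)).
Proof.
move=> sX sH; pose F a b := dotv (border X H v (rev (take a w)))
      (evw X (drop a (take b w)) *m border X H v (drop b w)).
rewrite shift_coef2 dotv_suml.
transitivity (\sum_(i < size w) \sum_(i.+1 <= b < size w) F i.+1 b).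
  apply: eq_bigr => i _.
  case E: (drop i w) => [|j b].
    by have := ltn_ord i; have /(congr1 size) := E; rewrite size_drop /=; lia.
  have Eb : b = drop i.+1 w by rewrite -add1n -drop_drop E drop1.
  have Et : rev (take i.+1 w) = j :: rev (take i w).
    rewrite (take_nth j) ?ltn_ord // rev_rcons.
    by rewrite -[i : nat]addn0 -nth_drop E addn0.
  rewrite /F Et /= mulmxA dotv_mull trmx_mul tr_evw // sH -mulmxA.
  rewrite mulmxA -mulmxA.
  rewrite dotvC shift_coef1 dotv_sumr -{1}[i.+1]add0n big_addn big_mkord.
  rewrite Eb size_drop; apply: eq_bigr => l _.
  by rewrite drop_drop take_drop.
rewrite -(big_mkord xpredT (fun i => \sum_(i.+1 <= b < size w) F i.+1 b)).
case: (size w) => [|m]; first by rewrite big_nil big_geq.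
rewrite big_nat_recr //= [X in _ + X]big_geq ?addr0 //.
by rewrite [RHS]big_add1.
Qed.

End Words.

(** * Removing [X] from the Hessian by a twist of the border vector *)

(* [al] is the beginning of the Taylor series of (1 - t)^(-1/2), the square
   root of the geometric series. *)
Lemma sqrt_geometric_series (R : realType) (m : nat) :
  exists al : nat -> R, al 0%N = 1 /\
    forall l, (l <= m)%N -> \sum_(i < l.+1) al i * al (l - i)%N = 1.
Proof.
elim: m => [|m [al [al0 alm]]].
  by exists (fun=> 1); split=> // -[|//] _; rewrite big_ord1 mulr1.
(* At [l = m.+1] the convolution is [2 * c] plus terms already fixed; [c] makes it equal to 1. *)
pose c := (1 - \sum_(i < m) al i.+1 * al (m - i)%N) / 2.
exists (fun i => if i == m.+1 then c else al i); split=> // l.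
rewrite leq_eqVlt => /predU1P[->|]; last first.
  rewrite ltnS => lm; rewrite -[RHS](alm l lm); apply: eq_bigr => i _.
  by have := ltn_ord i; rewrite ltnS => il; rewrite !ifN_eq //; lia.
rewrite big_ord_recl big_ord_recr /= subn0 subSS /bump /= add1n.
rewrite eqxx subnn al0 mulr1 mul1r.
rewrite (eq_bigr (fun i : 'I_m => al i.+1 * al (m - i)%N)).
  by rewrite /c; field.
by move=> i _; have := ltn_ord i => im; rewrite /bump /= add1n !ifN_eq //; lia.
Qed.

(** Put [a = k - i] and [b = k + j]. For fixed [a <= b] the cut [k] runs from [a] to [b], and the
    coefficients [al (k - a) * al (b - k)] sum to 1. *)
Lemma double_split_sum (R : realType) (al : nat -> R) (F : nat -> nat -> R) m :
  (forall l, (l < m)%N -> \sum_(i < l.+1) al i * al (l - i)%N = 1) ->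
  \sum_(1 <= k < m) \sum_(i < k) \sum_(j < m - k)
     al i * al j * F (k - i)%N (k + j)%N =
  \sum_(1 <= a < m) \sum_(a <= b < m) F a b.
Proof.
move=> alP.
have shift_sum k l (G : nat -> R) :
    \sum_(k <= b < l) G b = \sum_(j < l - k) G (j + k)%N.
  by rewrite -{1}[k]add0n big_addn big_mkord.
transitivity (\sum_(1 <= k < m) \sum_(1 <= a < m | (a <= k)%N)
    \sum_(1 <= b < m | (k <= b)%N) al (k - a)%N * al (b - k)%N * F a b).
  apply: eq_big_nat => k /andP[k0 km].
  rewrite -(big_mkord xpredT (fun i => \sum_(j < m - k)
     al i * al j * F (k - i)%N (k + j)%N)) big_nat_rev add0n /=.
  transitivity (\sum_(1 <= a < k.+1) \sum_(k <= b < m)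
       al (k - a)%N * al (b - k)%N * F a b).
    rewrite big_add1 /=; apply: eq_big_nat => a /andP[_ ak].
    rewrite shift_sum; apply: eq_bigr => j _.
    by congr (al _ * al _ * F _ _); lia.
  rewrite (big_nat_widen _ k.+1 m) //.
  apply: eq_big => [a|a _]; first by rewrite ltnS.
  by rewrite (big_nat_widenl k 1).
rewrite (exchange_big_dep_nat xpredT) //=; apply: eq_big_nat => a /andP[a0 am].
rewrite (exchange_big_dep_nat (fun b => (a <= b)%N)) /=; last first.
  by move=> k b _ _; apply: leq_trans.
rewrite (big_nat_widenl a 1) // big_nat_cond [RHS]big_nat_cond.
apply: eq_bigr => b /andP[/andP[b1 bm] /= ab].
rewrite -[RHS]mul1r -(alP (b - a)%N); last by lia.
rewrite mulr_suml.
transitivity (\sum_(a <= k < b.+1) al (k - a)%N * al (b - k)%N * F a b).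
  by rewrite (big_nat_widenl a 1) // (big_nat_widen _ b.+1 m).
rewrite shift_sum subSn //; apply: eq_bigr => -[i /= iab] _.
by congr (al _ * al _ * _); lia.
Qed.

Section Twist.
Variables (R : realType) (g n : nat) (al : nat -> R).
Implicit Types (X H : mxtuple R g n) (w : seq 'I_g) (u : seq 'I_g -> 'cV[R]_n).

(** The sum omits [i = size w], so the padding entry [u [::]] never enters. *)
Definition twist X u w : 'cV[R]_n :=
  \sum_(i < size w) al i *: (evw X (take i w) *m u (drop i w)).

(** Expanding both twists gives the sum of [double_split_sum]: the transposed left prefix and the
    right prefix join across the cut [k] to form the middle word. *)
Lemma twist_split X u w : symtuple X ->
  (forall l, (l < size w)%N -> \sum_(i < l.+1) al i * al (l - i)%N = 1) ->
  \sum_(1 <= k < size w) dotv (twist X u (rev (take k w))) (twist X u (drop k w))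
  = \sum_(1 <= a < size w) \sum_(a <= b < size w)
      dotv (u (rev (take a w))) (evw X (drop a (take b w)) *m u (drop b w)).
Proof.
move=> sX alP; pose F a b :=
  dotv (u (rev (take a w))) (evw X (drop a (take b w)) *m u (drop b w)).
rewrite -(double_split_sum F alP); apply: eq_big_nat => k /andP[k0 km].
rewrite /twist dotv_suml size_rev size_takel ?(ltnW km) //.
apply: eq_bigr => i _; rewrite dotv_sumr size_drop; apply: eq_bigr => j _.
have ik := ltn_ord i; have jm := ltn_ord j.
rewrite dotvZl dotvZr mulrA dotv_mull tr_evw // mulmxA -evw_cat.
rewrite drop_rev take_rev size_takel ?(ltnW km) // take_takel ?leq_subr //.
rewrite revK drop_drop [(j + k)%N]addnC; congr (_ * dotv _ (evw X _ *m _)).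
rewrite take_drop [(j + k)%N]addnC; set s := take (k + j) w.
have ss : size s = (k + j)%N by rewrite /s size_takel //; lia.
have -> : take k w = take k s by rewrite /s take_takel // leq_addr.
rewrite -[in RHS](cat_take_drop k s) drop_cat size_takel ?ss ?leq_addr //.
case: ltnP => // ki; rewrite (_ : k - i = k)%N; last by lia.
by rewrite subnn drop0 drop_oversize // size_takel // ss leq_addr.
Qed.

End Twist.

(** * Linear maps and dimension counts *)

Lemma linear_lfun (R : fieldType) (aT rT : vectType R) (f : aT -> rT) :
  linear f -> exists F : 'Hom(aT, rT), F =1 f.
Proof.
move=> lf; pose lM := GRing.isLinear.Build _ _ _ _ f lf.
pose L : {linear aT -> rT} := HB.pack f lM.
by exists (linfun L) => x; rewrite lfunE.
Qed.

Lemma dim_gt_ker (R : fieldType) (aT rT : vectType R) (F : 'Hom(aT, rT))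
    (U : {vspace aT}) : (dim rT < \dim U)%N ->
  exists x, [/\ x \in U, x != 0 & F x = 0].
Proof.
move=> ltU; exists (vpick (U :&: lker F)%VS).
have : vpick (U :&: lker F)%VS != 0.
  rewrite vpick0; apply: contraTneq ltU => UF0.
  by rewrite -leqNgt -(limg_dim_eq UF0) -dimvf dimvS ?subvf.
by have := memv_pick (U :&: lker F)%VS; rewrite memv_cap memv_ker => /andP[? /eqP].
Qed.

Lemma dim_lker_ge (R : fieldType) (aT rT : vectType R) (F : 'Hom(aT, rT)) :
  (dim aT - dim rT <= \dim (lker F))%N.
Proof.
rewrite leq_subLR -[dim aT]dimvf -(limg_ker_dim F fullv) capfv addnC leq_add2r.
by rewrite -dimvf dimvS ?subvf.
Qed.

(** * Maximal positive subspaces of a quadratic form *)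

Section QuadraticForm.
Variables (R : realFieldType) (N : nat) (P : 'M[R]_N).
Hypothesis symP : P^T = P.

Definition qform (x : 'rV[R]_N) : R := (x *m P *m x^T) 0 0.

(** Positivity is asked in terms of the coordinates [y], so the rows of [W] are independent and [m]
    is the dimension of a positive subspace. *)
Definition positive_rows m (W : 'M[R]_(m, N)) : Prop :=
  forall y : 'rV_m, y != 0 -> 0 < qform (y *m W).

Lemma positive_rows_leq m (W : 'M[R]_(m, N)) : positive_rows W -> (m <= N)%N.
Proof.
move=> posW; suff /eqP <- : row_free W by apply: rank_leq_col.
rewrite -kermx_eq0; apply/rowV0P => y /sub_kermxP yW0; apply/eqP.
by apply: contraTT isT => /posW; rewrite yW0 /qform mul0mx mul0mx mxE ltxx.
Qed.

(** A vector orthogonal to [W] for the form and of positive value could be appended to [W] as a new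
    row, so a [W] with the largest number of rows qualifies. *)
Lemma maximal_positive_rows : exists m (W : 'M[R]_(m, N)),
  positive_rows W /\ forall x, x *m P *m W^T = 0 -> qform x <= 0.
Proof.
have ex0 : exists m, `[< exists W : 'M[R]_(m, N), positive_rows W >].
  by exists 0%N; apply/asboolP; exists 0 => y; rewrite thinmx0 eqxx.
have bound m : `[< exists W : 'M[R]_(m, N), positive_rows W >] -> (m <= N)%N.
  by move=> /asboolP[W]; apply: positive_rows_leq.
case: (ex_maxnP ex0 bound) => m /asboolP[W posW] maxm.
exists m, W; split=> // x xPW; rewrite leNgt; apply/negP => x_gt0.
suff /asboolP/maxm : exists W : 'M[R]_(m + 1, N), positive_rows W by lia.
exists (col_mx W x) => y; rewrite -[y]hsubmxK mul_row_col.
set y1 := lsubmx y; set y2 := rsubmx y => y_neq0.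
have -> : qform (y1 *m W + y2 *m x) =
    qform (y1 *m W) + y2 0 0 ^+ 2 * qform x.
  rewrite /qform linearD /= !mulmxDl !mulmxDr.
  rewrite !trmx_mul.
  have cross0 : y2 *m (x *m P *m W^T) *m y1^T = 0 by rewrite xPW mulmx0 mul0mx.
  have -> : y2 *m x *m P *m (W^T *m y1^T) = 0.
    by rewrite -cross0 !mulmxA.
  have -> : y1 *m W *m P *m (x^T *m y2^T) = 0.
    apply: trmx_inj; rewrite !trmx_mul !trmxK symP trmx0.
    by rewrite -cross0 !mulmxA.
  rewrite addr0 add0r [in LHS]mxE; congr (_ + _).
  have -> : y2 = (y2 0 0)%:M by apply: mx11_scalar.
  move: (y2 0 0) => c; rewrite tr_scalar_mx mul_mx_scalar !mul_scalar_mx.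
  by rewrite -!scalemxAl -scalemxAr scalerA !mxE eqxx mulr1n expr2.
have [y1_0|/posW q1] := eqVneq y1 0.
  rewrite y1_0 /qform !mul0mx mxE add0r mulr_gt0 // exprn_even_gt0 //=.
  apply: contraNneq y_neq0 => y2_0; rewrite y1_0 [y2]mx11_scalar y2_0.
  by rewrite raddf0 row_mx0.
by rewrite ltr_wpDr // mulr_ge0 ?sqr_ge0 // ltW.
Qed.

Lemma trace_qform n (U : 'M[R]_(n, N)) :
  \tr (U *m P *m U^T) = \sum_i qform (row i U).
Proof.
rewrite /mxtrace; apply: eq_bigr => i _; rewrite /qform -row_mul.
by rewrite !mxE; apply: eq_bigr => j _; rewrite !mxE.
Qed.

Lemma trace_qform_gt0 n m (W : 'M[R]_(m, N)) (Y : 'M[R]_(n, m)) :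
  positive_rows W -> Y != 0 -> 0 < \tr (Y *m W *m P *m (Y *m W)^T).
Proof.
move=> posW Y0; rewrite trace_qform.
have ge0 i : 0 <= qform (row i (Y *m W)).
  rewrite row_mul; have [->|/posW/ltW//] := eqVneq (row i Y) 0.
  by rewrite /qform !mul0mx mxE.
have [i Yi] : exists i, row i Y != 0.
  apply/existsP; apply: contraNT Y0; rewrite negb_exists => /forallP Y0.
  by apply/eqP/row_matrixP => i; have:= Y0 i; rewrite negbK row0 => /eqP.
rewrite (bigD1 i) //= ltr_wpDr ?sumr_ge0 // row_mul; exact: posW.
Qed.

Lemma trace_qform_le0 n m (W : 'M[R]_(m, N)) (U : 'M[R]_(n, N)) :
  (forall x, x *m P *m W^T = 0 -> qform x <= 0) ->
  U *m P *m W^T = 0 -> \tr (U *m P *m U^T) <= 0.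
Proof.
move=> Wmax U0; rewrite trace_qform sumr_le0 // => i _; apply: Wmax.
by rewrite -!row_mul U0 row0.
Qed.

End QuadraticForm.

(** * Families of vectors indexed by words, stored as matrices *)

Section WordColumns.
Variables (R : realType) (g n d : nat).
Implicit Types (w : seq 'I_g) (u : seq 'I_g -> 'cV[R]_n).

Definition nwords : nat := #|{: {bseq d of 'I_g}}|.

Definition widx w : 'I_nwords := enum_rank (insub_bseq d w).

Definition wcol (U : 'M[R]_(n, nwords)) w : 'cV[R]_n := col (widx w) U.

Definition wmx u : 'M[R]_(n, nwords) := \matrix_(i, k)
  u (enum_val k : {bseq d of 'I_g}) i 0.

Lemma wcol_wmx u w : (size w <= d)%N -> wcol (wmx u) w = u w.
Proof.
move=> wd; apply/colP => i; rewrite !mxE /widx enum_rankK.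
by rewrite /insub_bseq val_insubd wd.
Qed.

Lemma wcol_inj (U V : 'M[R]_(n, nwords)) :
  (forall w, (size w <= d)%N -> wcol U w = wcol V w) -> U = V.
Proof.
move=> UV; apply/matrixP => i k; pose w := enum_val k : {bseq d of 'I_g}.
have <- : widx w = k by rewrite /widx /insub_bseq valKd enum_valK.
by have /colP/(_ i) := UV w (size_bseq w); rewrite !mxE.
Qed.

Lemma widx_inj w w' : (size w <= d)%N -> (size w' <= d)%N ->
  widx w = widx w' -> w = w'.
Proof.
move=> wd wd' /enum_rank_inj /(congr1 (@bseqval _ _)).
by rewrite /insub_bseq !val_insubd wd wd'.
Qed.

End WordColumns.
Arguments wmx {R g n} d u.

(** * The Hessian as a trace form of the middle matrix *)

Section HessianForm.
Variables (R : realType) (g : nat).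
Implicit Types p : ncpoly R g.

Lemma mcoeff_rev p (w : fmonom 'I_g) : ncsymmetric p ->
  mcoeff (FMonom (rev w)) p = mcoeff w p.
Proof.
move=> sp; rewrite -{2}sp /nctr raddf_sum /=.
have revK' : FMonom (rev (FMonom (rev w))) = w by case: w => w; rewrite revK.
under eq_bigr do rewrite mcoeffU.
have [rw|rw] := boolP (FMonom (rev w) \in msupp p).
  rewrite (big_rem (FMonom (rev w))) //= revK' eqxx mulr1n big_seq big1 ?addr0 //.
  move=> x; rewrite mem_rem_uniq ?fset_uniq // inE => /andP[xw _].
  case: eqP => // rx; case/eqP: xw; rewrite -rx.
  by case: (x) => y; rewrite revK.
rewrite mcoeff_outdom // big_seq big1 // => x xp; case: eqP => // rx.
case/negP: rw; rewrite -rx (_ : FMonom _ = x) //.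
by case: (x) => y; rewrite revK.
Qed.

Lemma perm_msupp_rev p : ncsymmetric p ->
  perm_eq (msupp p) [seq FMonom (rev w) | w : fmonom 'I_g <- msupp p].
Proof.
move=> sp; have revK' : involutive (fun w : fmonom 'I_g => FMonom (rev w)).
  by case=> w; rewrite revK.
apply: uniq_perm; rewrite ?map_inj_uniq ?fset_uniq //; first exact: can_inj revK'.
move=> w; rewrite -{2}[w]revK' mem_map; last exact: can_inj revK'.
by rewrite -!mcoeff_neq0 mcoeff_rev.
Qed.

(* The middle matrix of the Hessian at [X = 0], up to the factor 2: its entry
   at [(w1, w2)] is the coefficient of [rev w1 ++ w2], for [w1], [w2] nonempty. *)
Definition middle_mx d p : 'M[R]_(nwords g d) :=
  \sum_(w <- msupp p) mcoeff w p *: \sum_(1 <= k < size w)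
    delta_mx (widx d (rev (take k w))) (widx d (drop k w)).

(** Reversing [w] turns its cut at [k] into the cut at [size w - k] with the halves exchanged, and
    keeps its coefficient in [p]. *)
Lemma middle_mx_sym d p : ncsymmetric p -> (middle_mx d p)^T = middle_mx d p.
Proof.
move=> sp; rewrite /middle_mx raddf_sum.
rewrite (perm_big _ (perm_msupp_rev sp)) /= big_map; apply: eq_bigr => w _.
rewrite linearZ /= mcoeff_rev //; congr (_ *: _); rewrite raddf_sum size_rev.
rewrite big_nat_rev; apply: eq_big_nat => k /andP[k0 kw].
rewrite /= trmx_delta take_rev drop_rev revK add1n subSS.
by rewrite subKn // ltnW.
Qed.

Lemma trace_middle_mx d p n (U : 'M[R]_(n, nwords g d)) :
  \tr (U *m middle_mx d p *m U^T) =
  \sum_(w <- msupp p) mcoeff w p * \sum_(1 <= k < size w)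
    dotv (wcol U (rev (take k w))) (wcol U (drop k w)).
Proof.
rewrite /middle_mx mulmx_sumr mulmx_suml raddf_sum; apply: eq_bigr => w _.
rewrite -scalemxAr -scalemxAl /= mxtraceZ; congr (_ * _).
rewrite mulmx_sumr mulmx_suml raddf_sum; apply: eq_bigr => k _ /=.
rewrite -(mul_delta_mx (0 : 'I_1)) mulmxA -colE -mulmxA -rowE -tr_col.
by rewrite mxtrace_mulC trace_mx11 -/(dotv _ _) dotvC.
Qed.

(** Applied to each word of [p], [twist_split] absorbs the middle words into the twisted border
    vectors, and a matrix independent of [X] remains. *)
Lemma dotv_nchess d (al : nat -> R) p n (X H : mxtuple R g n) (v : 'cV[R]_n) :
  (ncdeg p <= d)%N -> symtuple X -> symtuple H ->
  (forall l, (l <= d)%N -> \sum_(i < l.+1) al i * al (l - i)%N = 1) ->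
  dotv (nchess p X H *m v) v =
  2 * (let U := wmx d (twist al X (border X H v)) in
       \tr (U *m middle_mx d p *m U^T)).
Proof.
move=> pd sX sH alP; rewrite nchessE /= trace_middle_mx.
rewrite -scalemxAl dotvZl; congr (_ * _).
rewrite mulmx_suml dotv_suml; apply: eq_big_seq => w wp.
rewrite -scalemxAl dotvZl; congr (_ * _); rewrite dotv_shift_coef2 //.
have wd := leq_trans (size_le_ncdeg wp) pd.
rewrite -(@twist_split _ _ _ al) //; last first.
  by move=> l lw; apply: alP; exact: leq_trans (ltnW lw) wd.
apply: eq_big_nat => k /andP[k0 kw]; rewrite !wcol_wmx //.
  by rewrite size_drop (leq_trans (leq_subr _ _)).
by rewrite size_rev size_takel ?(leq_trans (ltnW kw)) // ltnW.
Qed.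

End HessianForm.

(** * Linearity of borders and twists *)

Section Linearity.
Variables (R : realType) (g n : nat).
Implicit Types (X H : mxtuple R g n) (w : seq 'I_g) (u : seq 'I_g -> 'cV[R]_n).

Lemma border_linear X (a : R) H1 H2 v w :
  border X (a *: H1 + H2) v w = a *: border X H1 v w + border X H2 v w.
Proof.
case: w => [|j b] /=; first by rewrite scaler0 addr0.
by rewrite !ffunE mulmxDl scalemxAl.
Qed.

Lemma twist_linear al X (a : R) u u1 u2 w :
  (forall w', u w' = a *: u1 w' + u2 w') ->
  twist al X u w = a *: twist al X u1 w + twist al X u2 w.
Proof.
move=> uE; rewrite /twist scaler_sumr -big_split; apply: eq_bigr => i _ /=.
by rewrite uE mulmxDr scalerDr -scalemxAr !scalerA mulrC.
Qed.

Lemma wmx_linear d (a : R) u u1 u2 :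
  (forall w, (size w <= d)%N -> u w = a *: u1 w + u2 w) ->
  wmx d u = a *: wmx d u1 + wmx d u2.
Proof.
move=> uE; apply/matrixP => i k; rewrite !mxE uE ?mxE //.
exact: (size_bseq (enum_val k : {bseq d of 'I_g})).
Qed.

Lemma wcol_linear d (a : R) (U V : 'M[R]_(n, nwords g d)) w :
  wcol (a *: U + V) w = a *: wcol U w + wcol V w.
Proof. by rewrite /wcol linearP. Qed.

Lemma eq_twist al X u1 u2 w :
  (forall w', (0 < size w' <= size w)%N -> u1 w' = u2 w') ->
  twist al X u1 w = twist al X u2 w.
Proof.
move=> u12; apply: eq_bigr => i _; rewrite u12 // size_drop leq_subr.
by rewrite subn_gt0 ltn_ord.
Qed.

End Linearity.

(** * Upper bound for the signature *)

Section CurvatureBounds.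
Variables (R : realType) (g n d : nat).
Implicit Types (p : ncpoly R g) (X : mxtuple R g n) (v : 'cV[R]_n).

Lemma dim_le_curv_dim s p X v (U : {vspace mxtuple R g n}) :
  definite_on s p X v U -> (\dim U <= curv_dim s p X v)%N.
Proof.
move=> defU; have dU : (\dim U < (\dim {: mxtuple R g n}).+1)%N.
  by rewrite ltnS dimvS ?subvf.
apply: (leq_bigmax_cond (F := fun k : 'I_(\dim {: mxtuple R g n}).+1 => k : nat)
          (Ordinal dU)).
by apply/asboolP; exists U.
Qed.

Lemma curv_dim_leP s p X v k :
  (forall U, definite_on s p X v U -> (\dim U <= k)%N) ->
  (curv_dim s p X v <= k)%N.
Proof.
by move=> Uk; apply/bigmax_leqP => i /asboolP[U <- defU]; apply: Uk.
Qed.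

Definition signed_middle_mx s p := (-1) ^+ (s : bool) *: middle_mx d p.

Lemma trace_signed_middle_mx s p (U : 'M[R]_(n, nwords g d)) :
  \tr (U *m signed_middle_mx s p *m U^T) =
  (-1) ^+ s * \tr (U *m middle_mx d p *m U^T).
Proof. by rewrite -scalemxAr -scalemxAl mxtraceZ. Qed.

(** In a space of dimension above [n * m] some nonzero [H] has a twisted border orthogonal to [W]
    for the form, these being [n * m] linear equations. By the hypothesis on [W] the signed Hessian
    is then nonpositive at [H]. *)
Lemma curv_dim_le s p X v m (W : 'M[R]_(m, nwords g d)) :
  (ncdeg p <= d)%N -> symtuple X ->
  (forall x, x *m signed_middle_mx s p *m W^T = 0 ->
     qform (signed_middle_mx s p) x <= 0) ->
  (curv_dim s p X v <= n * m)%N.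
Proof.
move=> pd sX Wmax; apply: curv_dim_leP => U [symU posU].
have [al [al0 alP]] := sqrt_geometric_series R d.
pose Z H := wmx d (twist al X (border X H v)).
have [F FE] : exists F : 'Hom(mxtuple R g n, 'M[R]_(n, m)),
    F =1 (fun H => Z H *m signed_middle_mx s p *m W^T).
  apply: linear_lfun => a H1 H2.
  rewrite /Z (wmx_linear (a := a) (u1 := twist al X (border X H1 v))
    (u2 := twist al X (border X H2 v))) ?mulmxDl -?scalemxAl //.
  by move=> w _; apply: twist_linear => w'; exact: border_linear.
have dimM : dim 'M[R]_(n, m) = (n * m)%N := dim_matrix _ _ _.
rewrite leqNgt -dimM; apply/negP => /(dim_gt_ker F)[H [HU H0]].
rewrite FE => ZH0; have := posU H HU H0; apply/negP; rewrite -leNgt.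
rewrite (dotv_nchess _ pd sX (symU H HU).1 alP) mulrCA -trace_signed_middle_mx.
by rewrite pmulr_rle0 //; apply: trace_qform_le0 ZH0.
Qed.

(** As [al 0 = 1], the twist, completed by the identity on the empty word, is unitriangular for the
    length of words; hence it is injective and, in finite dimension, invertible. *)
Lemma twist_inverse (al : nat -> R) X : al 0%N = 1 ->
  exists G : 'Hom('M[R]_(n, nwords g d), 'M[R]_(n, nwords g d)),
    forall Z w, (0 < size w <= d)%N -> twist al X (wcol (G Z)) w = wcol Z w.
Proof.
move=> al0.
pose T (U : 'M[R]_(n, nwords g d)) w :=
  if w is [::] then wcol U [::] else twist al X (wcol U) w.
have [F FE] : exists F : 'Hom('M[R]_(n, nwords g d), 'M[R]_(n, nwords g d)),
    F =1 (fun U => wmx d (T U)).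
  apply: linear_lfun => a U V; apply: wmx_linear => -[|j w] _ /=.
    exact: wcol_linear.
  by apply: twist_linear => w'; exact: wcol_linear.
have kerF : lker F == 0%VS.
  rewrite -subv0; apply/subvP => U; rewrite memv_ker memv0 FE => /eqP FU0.
  have TU0 w : (size w <= d)%N -> T U w = 0.
    by move=> wd; rewrite -(wcol_wmx (T U) wd) FU0 /wcol linear0.
  suff U0 k w : (size w <= k)%N -> (size w <= d)%N -> wcol U w = 0.
    by apply/eqP/wcol_inj => w wd; rewrite (U0 _ _ (leqnn _) wd) /wcol linear0.
  elim: k w => [|k IHk] w; first by case: w => // _; apply: (TU0 [::]).
  rewrite leq_eqVlt => /predU1P[wk|/IHk//] wd.
  have := TU0 w wd; case: w => [|j w] in wk wd * => // /=.
  rewrite /twist big_ord_recl /= al0 scale1r evw_nil mul1mx big1 ?addr0 //.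
  move=> i _; rewrite /bump add1n /= IHk ?mulmx0 ?scaler0 //.
    by rewrite size_drop -ltnS -wk /= ltnS leq_subr.
  by rewrite size_drop (leq_trans (leq_subr _ _)) // ltnW.
exists F^-1%VF => Z w /andP[w0 wd].
rewrite -[in RHS](lker0_lfunVK kerF Z) FE wcol_wmx //.
by case: w w0 wd.
Qed.

End CurvatureBounds.

(** * The constraint [p'(X)[H] v = 0] as an equation in the border vector *)

Section BorderDerivative.
Variables (R : realType) (g n : nat) (p : ncpoly R g) (X : mxtuple R g n).
Implicit Types (w : seq 'I_g) (u : seq 'I_g -> 'cV[R]_n).

(** The vector [p'(X)[H] v] as a function of the border vector, extended to families [u] that need
    not come from any [H]. *)
Definition border_deriv u : 'cV[R]_n :=
  \sum_(w <- msupp p) mcoeff w p *: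
    \sum_(i < size w) evw X (take i w) *m u (drop i w).

Lemma ncderiv_border H v : ncderiv p X H *m v = border_deriv (border X H v).
Proof.
rewrite ncderivE mulmx_suml; apply: eq_bigr => w _.
by rewrite -scalemxAl shift_coef1.
Qed.

Lemma eq_border_deriv u1 u2 :
  (forall w, (0 < size w <= ncdeg p)%N -> u1 w = u2 w) ->
  border_deriv u1 = border_deriv u2.
Proof.
move=> u12; apply: eq_big_seq => w wp; congr (_ *: _); apply: eq_bigr => i _.
rewrite u12 // size_drop subn_gt0 ltn_ord.
by rewrite (leq_trans (leq_subr _ _)) // size_le_ncdeg.
Qed.

Lemma border_deriv_linear (a : R) u u1 u2 : u =1 (fun w => a *: u1 w + u2 w) ->
  border_deriv u = a *: border_deriv u1 + border_deriv u2.
Proof.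
move=> uE; rewrite /border_deriv scaler_sumr -big_split; apply: eq_bigr => w _ /=.
rewrite scalerA mulrC -scalerA -scalerDr; congr (_ *: _).
rewrite scaler_sumr -big_split; apply: eq_bigr => i _ /=.
by rewrite uE mulmxDr scalemxAr.
Qed.

(** A word of maximal length is a suffix of no word of [p] other than itself, and there the prefix
    is empty. *)
Lemma border_deriv_top (w0 : fmonom 'I_g) (c : 'cV[R]_n) :
  w0 \in msupp p -> size w0 = ncdeg p -> (0 < ncdeg p)%N ->
  border_deriv (fun w => if w == w0 then c else 0) = mcoeff w0 p *: c.
Proof.
move=> w0p sw0 d0; rewrite /border_deriv (big_rem w0) //= [X in _ + X]big_seq.
rewrite [X in _ + X]big1 ?addr0.
  congr (_ *: _); rewrite -[LHS](big_mkord xpredT (fun i =>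
    evw X (take i w0) *m (if drop i w0 == w0 then c else 0))).
  rewrite big_ltn ?sw0 // take0 drop0 eqxx evw_nil mul1mx big_nat big1 ?addr0 //.
  move=> i /andP[i0 id]; case: eqP => [/(congr1 size)|_]; last by rewrite mulmx0.
  by rewrite size_drop !sw0; lia.
move=> w; rewrite mem_rem_uniq ?fset_uniq // inE => /andP[ww0 wp].
rewrite big1 ?scaler0 // => i _; case: eqP => [dw|_]; last by rewrite mulmx0.
have i0 : (i : nat) = 0%N.
  case: (posnP i) => // i_gt0; have : (size w - i < size w)%N.
    by rewrite ltn_subrL i_gt0 (leq_ltn_trans _ (ltn_ord i)).
  by rewrite -size_drop dw sw0 ltnNge size_le_ncdeg.
case/eqP: ww0; move: dw; rewrite i0 drop0; case: (w) (w0) => x [y] /= ->.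
by [].
Qed.

End BorderDerivative.

Lemma ncdeg_attained (R : realType) (g : nat) (p : ncpoly R g) :
  (0 < ncdeg p)%N -> exists2 w, w \in msupp p & size w = ncdeg p.
Proof.
move=> d0; suff /allPn[w wp] : ~~ all (fun w : fmonom 'I_g =>
      size w < ncdeg p)%N (msupp p).
  rewrite -leqNgt => dw; exists w => //.
  by apply/eqP; rewrite eqn_leq dw size_le_ncdeg.
apply/negP => /allP ltd; suff : (ncdeg p <= (ncdeg p).-1)%N by lia.
by apply/bigmax_leqP_seq => w wp _; rewrite -ltnS prednK // ltd.
Qed.

Lemma shift_coef_dir0 (R : realType) (g n : nat) (X : mxtuple R g n) w k :
  shift_coef X 0 w k.+1 = 0.
Proof.
elim: w k => [|j w IHw] k //=.
by rewrite IHw mulmx0 ffunE mul0mx addr0.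
Qed.

(* The columns indexed by words of maximal length do not enter the Hessian, so
   one of them can be used to solve the equation [border_deriv p X u = 0]. *)
Lemma twist_section (R : realType) (g n d : nat) (al : nat -> R)
    (p : ncpoly R g) (X : mxtuple R g n) :
  al 0%N = 1 -> ncdeg p = d.+1 ->
  exists U : 'Hom('M[R]_(n, nwords g d.+1), 'M[R]_(n, nwords g d.+1)),
    (forall Z w, (0 < size w <= d)%N -> twist al X (wcol (U Z)) w = wcol Z w) /\
    (forall Z, border_deriv p X (wcol (U Z)) = 0).
Proof.
move=> al0 dp; have dp0 : (0 < ncdeg p)%N by rewrite dp.
have [w0 w0p sw0] := ncdeg_attained dp0.
have [G GP] := @twist_inverse R g n d.+1 al X al0.
(* Placed at the top word [w0], [c Z] cancels the derivative of the untwisted family [G Z]. *)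
have [c cE] : exists c : 'Hom('M[R]_(n, nwords g d.+1), 'cV[R]_n),
    c =1 (fun Z => - (mcoeff w0 p)^-1 *: border_deriv p X (wcol (G Z))).
  apply: linear_lfun => a Z Z'.
  rewrite (@border_deriv_linear _ _ _ p X a _ (wcol (G Z)) (wcol (G Z'))).
    by rewrite scalerDr scalerA mulrC -scalerA.
  by move=> w; rewrite linearP wcol_linear.
have [U UE] : exists U : 'Hom('M[R]_(n, nwords g d.+1), 'M[R]_(n, nwords g d.+1)),
    U =1 (fun Z => G Z + c Z *m delta_mx 0 (widx d.+1 w0)).
  apply: linear_lfun => a Z Z'.
  by rewrite !linearP /= mulmxDl -scalemxAl scalerDr addrACA.
have colU Z w : (size w <= d.+1)%N ->
    wcol (U Z) w = wcol (G Z) w + (if w == w0 then c Z else 0).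
  move=> wd; rewrite UE /wcol linearD /=; congr (_ + _).
  apply/colP => i; rewrite !mxE big_ord1 !mxE eqxx /=.
  have [->|ww0] := eqVneq w (w0 : seq 'I_g); first by rewrite eqxx mulr1.
  case: eqP => [/widx_inj|]; last by rewrite mulr0 mxE.
  by rewrite sw0 dp => /(_ wd (leqnn _)) ww0'; rewrite ww0' eqxx in ww0.
exists U; split=> [Z w /andP[w_gt0 wd]|Z].
  (* A word of length at most [d] does not have [w0] as a suffix, so the correction leaves its twist
     unchanged. *)
  rewrite -GP ?w_gt0 ?(leq_trans wd) //; apply: eq_twist => w' /andP[w'0 w'w].
  rewrite colU; last by rewrite (leq_trans w'w) // (leq_trans wd).
  case: eqP => [w'E|_]; last by rewrite addr0.
  by have := leq_trans w'w wd; rewrite w'E sw0 dp ltnn.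
pose e (w : seq 'I_g) := if w == w0 then c Z else 0.
rewrite (@eq_border_deriv _ _ _ _ _ _ (fun w => 1 *: e w + wcol (G Z) w)).
  rewrite (@border_deriv_linear _ _ _ p X 1 _ e (wcol (G Z))) //.
  rewrite border_deriv_top // cE scale1r scalerA mulrN divff ?mcoeff_neq0 //.
  by rewrite scaleN1r addNr.
by move=> w; rewrite dp => /andP[_ wd]; rewrite colU // scale1r addrC.
Qed.

(** * Lower bound for the signature *)

(* If [v_1 .. v_k] are the columns of [E], then [F] is a dual basis and [H_j] is
   the symmetric matrix sending [v_b] to the [b]-th column of [Uj j]. *)
Lemma symmetric_interpolation (R : realType) (g n k l : nat)
    (E F : 'M[R]_(n, k)) (U : 'M[R]_(n, l) -> 'I_g -> 'M[R]_(n, k)) :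
  (forall a Y Y' j, U (a *: Y + Y') j = a *: U Y j + U Y' j) -> F^T *m E = 1%:M ->
  exists H : 'Hom('M[R]_(n, l), mxtuple R g n),
    (forall Y, symtuple (H Y)) /\
    (forall Y j, (U Y j)^T *m E = 0 -> H Y j *m E = U Y j).
Proof.
move=> UL FE.
have [H HE] : exists H : 'Hom('M[R]_(n, l), mxtuple R g n),
    H =1 (fun Y => [ffun j => U Y j *m F^T + F *m (U Y j)^T]).
  apply: linear_lfun => a Y Y'; apply/ffunP => j.
  rewrite ![in RHS]ffunE ffunE UL mulmxDl linearP /= mulmxDr.
  by rewrite -scalemxAl -scalemxAr scalerDr addrACA.
exists H; split=> [Y j|Y j UE0]; rewrite HE ffunE.
  by rewrite linearD /= !trmx_mul !trmxK addrC.
by rewrite mulmxDl -!mulmxA FE UE0 mulmx0 mulmx1 addr0.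
Qed.

(** Each [Y] prescribes the twisted border [Y *m W], on which the form is positive; untwisting gives
    the border [U Y], and [T Y = 0] lets a symmetric [H Y] realize it. The codimension of the kernel
    of [T] is bounded independently of [n]. *)
Lemma curv_dim_ge (R : realType) (g n d : nat) s (p : ncpoly R g)
    (X : mxtuple R g n) (v : 'cV[R]_n) m (W : 'M[R]_(m, nwords g d.+1))
    (F : 'M[R]_(n, nwords g d)) :
  ncdeg p = d.+1 -> symtuple X -> positive_rows (signed_middle_mx d.+1 s p) W ->
  F^T *m wmx d (fun b => evw X b *m v) = 1%:M ->
  (n * m - nwords g d.+1 * nwords g d <= curv_dim s p X v)%N.
Proof.
move=> dp sX posW; set E := wmx d _ => FE.
have [al [al0 alP]] := sqrt_geometric_series R d.+1.
have [U0 [twU0 derivU0]] := twist_section X al0 dp.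
have [U UE] : exists U : 'Hom('M[R]_(n, m), 'M[R]_(n, nwords g d.+1)),
    U =1 (fun Y => U0 (Y *m W)).
  by apply: linear_lfun => a Y Y'; rewrite mulmxDl -scalemxAl linearP.
pose Uj Y j := wmx d (fun b => wcol (U Y) (j :: b)).
have UjL a Y Y' j : Uj (a *: Y + Y') j = a *: Uj Y j + Uj Y' j.
  by apply: wmx_linear => b _; rewrite linearP wcol_linear.
have [H [sH HE]] := symmetric_interpolation UjL FE.
have [T TE] : exists T : 'Hom('M[R]_(n, m), 'M[R]_(nwords g d.+1, nwords g d)),
    T =1 (fun Y => (U Y)^T *m E).
  apply: linear_lfun => a Y Y'.
  by rewrite linearP linearD linearZ /= mulmxDl scalemxAl.
have borderU Y w : T Y = 0 -> (0 < size w <= d.+1)%N ->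
    border X (H Y) v w = wcol (U Y) w.
  rewrite TE; case: w => // j b TY0 /= bd.
  have -> : evw X b *m v = wcol E b by rewrite wcol_wmx.
  rewrite /wcol colE mulmxA -colE HE.
    by rewrite -[LHS]/(wcol (Uj Y j) b) wcol_wmx.
  apply/row_matrixP => k; rewrite row_mul row0.
  have -> : row k (Uj Y j)^T =
     row (widx d.+1 (j :: (enum_val k : {bseq d of 'I_g}))) (U Y)^T.
    by apply/rowP => i; rewrite !mxE.
  by rewrite -row_mul TY0 row0.
have hessU Y : T Y = 0 -> (-1) ^+ s * dotv (nchess p X (H Y) *m v) v =
    2 * \tr (Y *m W *m signed_middle_mx d.+1 s p *m (Y *m W)^T).
  move=> TY0; rewrite (@dotv_nchess _ _ d.+1 al) ?dp // mulrCA /=.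
  rewrite trace_signed_middle_mx !trace_middle_mx; do 2!congr (_ * _).
  apply: eq_big_seq => w wp; congr (_ * _).
  have wd : (size (w : seq 'I_g) <= d.+1)%N by rewrite -dp size_le_ncdeg.
  (* The Hessian sees only proper nonempty prefixes and suffixes of words of [p]; they have length
     at most [d], where the twist of [U Y] is [Y *m W]. *)
  have twistE w' : (0 < size w' < size (w : seq 'I_g))%N ->
      wcol (wmx d.+1 (twist al X (border X (H Y) v))) w' = wcol (Y *m W) w'.
    move=> /andP[w'0 w'w]; rewrite wcol_wmx; last by lia.
    rewrite -twU0; last by lia.
    by apply: eq_twist => w2 /andP[w20 w2w]; rewrite borderU ?UE //; lia.
  apply: eq_big_nat => k /andP[k0 kw]; rewrite !twistE //.
    by rewrite size_drop subn_gt0 kw ltn_subrL k0 (leq_ltn_trans _ kw).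
  by rewrite size_rev size_takel ?k0 // ltnW.
have posH Y : T Y = 0 -> Y != 0 ->
    0 < (-1) ^+ s * dotv (nchess p X (H Y) *m v) v.
  by move=> TY0 Y0; rewrite hessU // mulr_gt0 // trace_qform_gt0.
(* [H] is injective on the kernel of [T]: the Hessian is nonzero at [H Y] for [Y != 0], but vanishes
   in the direction 0. *)
have dimE : \dim (H @: lker T)%VS = \dim (lker T).
  apply: limg_dim_eq; apply/eqP; rewrite -subv0; apply/subvP => Y.
  rewrite memv_cap !memv_ker memv0 => /andP[/eqP TY0 /eqP HY0].
  apply: contraTT isT => /(posH Y TY0); rewrite HY0 nchessE.
  rewrite big1 => [|w _]; last by rewrite shift_coef_dir0 scaler0.
  by rewrite scaler0 mul0mx /dotv trmx0 mul0mx mxE mulr0 ltxx.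
have dimM a b : dim 'M[R]_(a, b) = (a * b)%N := dim_matrix _ _ _.
have := dim_lker_ge T; rewrite !dimM -dimE => /leq_trans; apply.
apply: dim_le_curv_dim; split=> K /memv_imgP[Y].
  rewrite memv_ker => /eqP TY0 ->; rewrite ncderiv_border; split=> //.
  rewrite -(derivU0 (Y *m W)); apply: eq_border_deriv => w.
  by rewrite dp -UE; exact: borderU.
rewrite memv_ker => /eqP TY0 -> HY0; apply: posH => //.
by apply/eqP => Y0; rewrite Y0 linear0 eqxx in HY0.
Qed.

(** * Pairs of the variety with independent vectors [b(X) v] *)

Section DirectSum.
Variables (R : realType) (g n1 n2 : nat).
Implicit Types (X : mxtuple R g n1) (Y : mxtuple R g n2).

Definition dsum X Y : mxtuple R g (n1 + n2) :=
  [ffun j => block_mx (X j) 0 0 (Y j)].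

Lemma evw_dsum X Y w : evw (dsum X Y) w = block_mx (evw X w) 0 0 (evw Y w).
Proof.
elim: w => [|j w IHw]; first by rewrite !evw_nil -scalar_mx_block.
rewrite !evw_cons IHw ffunE mulmx_block.
by rewrite !mul0mx !mulmx0 !addr0 !add0r.
Qed.

Lemma evw_dsum_col X Y w v1 v2 :
  evw (dsum X Y) w *m col_mx v1 v2 = col_mx (evw X w *m v1) (evw Y w *m v2 : 'cV_n2).
Proof. by rewrite evw_dsum mul_block_col !mul0mx addr0 add0r. Qed.

Lemma in_variety_dsum (p : ncpoly R g) X Y v1 v2 :
  in_variety p X v1 -> in_variety p Y v2 ->
  in_variety p (dsum X Y) (col_mx v1 v2).
Proof.
move=> [sX pX] [sY pY]; split=> [j|].
  by rewrite ffunE tr_block_mx !trmx0 sX sY.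
rewrite ncevalE mulmx_suml.
transitivity (col_mx (nceval p X *m v1) (nceval p Y *m v2)).
  rewrite !ncevalE !mulmx_suml; elim/big_rec3: _ => [|w A B C _ ->].
    by rewrite col_mx0.
  by rewrite -scalemxAl evw_dsum_col scale_col_mx add_col_mx -!scalemxAl.
by rewrite pX pY col_mx0.
Qed.

Lemma wmx_evw_dsum d X Y v1 v2 :
  wmx d (fun b => evw (dsum X Y) b *m col_mx v1 v2) =
  col_mx (wmx d (fun b => evw X b *m v1)) (wmx d (fun b => evw Y b *m v2)).
Proof.
apply/matrixP => i k; rewrite mxE evw_dsum_col.
by case: (split_ordP i) => i0 ->; rewrite !(col_mxEu, col_mxEd) !mxE.
Qed.

End DirectSum.

(** Gram-Schmidt, dropping each row that lies in the span of those already treated. *)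
Lemma orthonormal_rows (R : rcfType) (n k : nat) (A : 'M[R]_(k, n)) :
  exists r (Q : 'M[R]_(r, n)), [/\ (r <= k)%N, Q *m Q^T = 1%:M & (A <= Q)%MS].
Proof.
elim: k A => [|k IHk].
  move=> A; exists 0%N, 0; split=> //; first by rewrite [RHS]flatmx0 [LHS]flatmx0.
  by rewrite [A]flatmx0 sub0mx.
rewrite -add1n => A; rewrite -[A]vsubmxK; set a := usubmx _; set A' := dsubmx _.
have [r [Q [rk QQ A'Q]]] := IHk A'; pose x := a - a *m Q^T *m Q.
have xQ : x *m Q^T = 0 by rewrite mulmxBl -!mulmxA QQ mulmx1 subrr.
have aE : a = x + a *m Q^T *m Q by rewrite subrK.
clearbody x; have [x0|x_neq0] := eqVneq x 0.
  exists r, Q; split=> //; first exact: leqW.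
  by rewrite col_mx_sub A'Q aE x0 add0r submxMl.
pose c := (x *m x^T) 0 0.
have c_gt0 : 0 < c.
  have cE : c = \sum_i x 0 i ^+ 2.
    by rewrite /c mxE; apply: eq_bigr => i _; rewrite mxE expr2.
  rewrite lt0r cE sumr_ge0 ?andbT => [|i _]; last exact: sqr_ge0.
  apply: contra_neq x_neq0 => /psumr_eq0P x0; apply/rowP => i; rewrite mxE.
  by apply/eqP; rewrite -sqrf_eq0; apply/eqP/x0 => // j _; exact: sqr_ge0.
pose y := (Num.sqrt c)^-1 *: x.
have sc0 : Num.sqrt c != 0 by rewrite gt_eqF ?sqrtr_gt0.
have yQ : y *m Q^T = 0 by rewrite -scalemxAl xQ scaler0.
have yy : y *m y^T = 1%:M.
  rewrite /y linearZ /= -scalemxAr -scalemxAl scalerA [x *m _]mx11_scalar -/c.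
  by rewrite scale_scalar_mx -invfM -expr2 sqr_sqrtr ?ltW // mulVf // gt_eqF.
have Qy : Q *m y^T = 0 by apply: trmx_inj; rewrite trmx_mul trmxK yQ trmx0.
exists (1 + r)%N, (col_mx y Q); split=> //.
  by rewrite tr_col_mx mul_col_row QQ yQ Qy yy -scalar_mx_block.
have subQ : (Q <= col_mx y Q)%MS by rewrite -addsmxE addsmxSr.
rewrite col_mx_sub (submx_trans A'Q subQ) andbT aE addmx_sub //.
  have -> : x = Num.sqrt c *: y by rewrite scalerA divff // scale1r.
  by rewrite scalemx_sub // -addsmxE addsmxSl.
by rewrite (submx_trans _ subQ) // submxMl.
Qed.

Section GenericPairs.
Variables (R : realType) (g d : nat) (p : ncpoly R g).
Hypothesis dp : ncdeg p = d.+1.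

(** The vectors [b(X) v] are the columns, so [row_full (E X v)] says that they are independent. *)
Let E n (X : mxtuple R g n) v := wmx d (fun b => evw X b *m v).

Lemma nceval_words n (q : ncpoly R g) (X : mxtuple R g n) : (ncdeg q <= d)%N ->
  nceval q X = \sum_(b : {bseq d of 'I_g}) mcoeff (FMonom b) q *: evw X b.
Proof.
move=> qd; rewrite ncevalE.
rewrite (bigID (fun b : {bseq d of 'I_g} => FMonom b \in msupp q)) /=.
rewrite [X in _ + X]big1 ?addr0 => [|b bq]; last by rewrite mcoeff_outdom ?scale0r.
pose supp := [seq b <- index_enum {bseq d of 'I_g} | FMonom (bseqval b) \in msupp q].
transitivity (\sum_(w <- [seq FMonom (bseqval b) | b <- supp])
    mcoeff w q *: evw X w); last by rewrite big_map big_filter.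
apply: perm_big; apply: uniq_perm; first exact: fset_uniq.
  rewrite map_inj_uniq ?filter_uniq ?index_enum_uniq //.
  by move=> b c [/val_inj].
move=> w; apply/idP/mapP => [wq|[b]]; last first.
  by rewrite mem_filter => /andP[bq _ ->].
have wd : (size (w : seq 'I_g) <= d)%N by apply: leq_trans qd; exact: size_le_ncdeg.
case: w wq wd => w wq wd; exists (Bseq wd) => //.
by rewrite mem_filter mem_index_enum andbT.
Qed.

(** [a] lists the coefficients of a nonzero [q] of degree at most [d], and [E X v *m a] is [q(X) v];
    were it always 0, [q] would contradict the minimality of the degree of [p]. *)
Lemma separating_pair (a : 'cV[R]_(nwords g d)) :
  min_degree_defining p -> a != 0 ->
  exists n (X : mxtuple R g n) v, in_variety p X v /\ E X v *m a != 0.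
Proof.
move=> minp a0; apply: contrapT => noX.
pose q : ncpoly R g :=
  \sum_k mkmalgU (FMonom (enum_val k : {bseq d of 'I_g})) (a k 0).
have qE k : mcoeff (FMonom (enum_val k : {bseq d of 'I_g})) q = a k 0.
  rewrite /q raddf_sum (bigD1 k) //= mcoeffU eqxx mulr1n big1 ?addr0 // => i ik.
  rewrite mcoeffU; case: eqP => // -[/val_inj/enum_val_inj ik'].
  by rewrite ik' eqxx in ik.
have q0 : q != 0.
  apply: contra_neq a0 => q0; apply/colP => k.
  by rewrite -qE q0 mcoeff0 mxE.
have qd : (ncdeg q <= d)%N.
  apply/bigmax_leqP_seq => w wq _; rewrite leqNgt; apply/negP => dw.
  move: wq; rewrite -mcoeff_neq0 /q raddf_sum big1 ?eqxx // => k _ /=.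
  rewrite mcoeffU; case: eqP => // wE; move: dw; rewrite -wE /fdeg /=.
  by rewrite ltnNge size_bseq.
suff : (ncdeg p <= ncdeg q)%N by rewrite dp leqNgt ltnS qd.
apply: minp => // n X v _ pX; apply: contrapT => /eqP qX0; apply: noX.
exists n, X, v; split=> //; apply: contra_neq qX0 => Ea0.
rewrite -[RHS]Ea0 (nceval_words _ qd) mulmx_suml.
apply/colP => i; rewrite summxE mxE.
rewrite [RHS](reindex (@enum_rank {bseq d of 'I_g})) /=; last first.
  exact: onW_bij (enum_rank_bij _).
apply: eq_bigr => b _; have qb : mcoeff (FMonom b) q = a (enum_rank b) 0.
  by rewrite -qE enum_rankK.
by rewrite -scalemxAl mxE mulrC qb [in RHS]mxE enum_rankK.
Qed.

(** At a pair of maximal rank, a nonzero kernel vector of [E X v] would be separated by another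
    pair, and the direct sum with it would have larger rank. *)
Lemma generic_pair : min_degree_defining p ->
  exists n (X : mxtuple R g n) v, in_variety p X v /\ row_full (E X v).
Proof.
move=> minp.
pose P r := `[< exists n (X : mxtuple R g n) v,
  in_variety p X v /\ \rank (E X v) = r >].
have exP : exists r, P r.
  exists (\rank (E (0 : mxtuple R g 0) 0)); apply/asboolP.
  exists 0%N, 0, 0; split=> //.
  by split=> [j|]; [rewrite ffunE trmx0 | rewrite mulmx0].
have bP r : P r -> (r <= nwords g d)%N.
  by move=> /asboolP[n [X [v [_ <-]]]]; exact: rank_leq_col.
case: (ex_maxnP exP bP) => r /asboolP[n [X [v [pX rX]]]] maxr.
exists n, X, v; split=> //; apply: contrapT => /negP nfull.
have [a a0 Ea0] : exists2 a : 'cV[R]_(nwords g d), a != 0 & E X v *m a = 0.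
  have : kermx (E X v)^T != 0.
    by rewrite kermx_eq0 /row_free mxrank_tr.
  case/rowV0Pn => a /sub_kermxP aE a0; exists a^T; first by rewrite trmx_eq0.
  by apply: trmx_inj; rewrite trmx_mul trmxK aE trmx0.
have [n' [X' [v' [pX' EX'a]]]] := separating_pair minp a0.
have /maxr : P (\rank (E (dsum X X') (col_mx v v'))).
  apply/asboolP; exists (n + n')%N, (dsum X X'), (col_mx v v').
  by split=> //; exact: in_variety_dsum.
rewrite /E wmx_evw_dsum -rX leqNgt => /negP; apply.
suff : (E X v < col_mx (E X v) (E X' v'))%MS by rewrite ltmxErank => /andP[].
rewrite ltmxE -addsmxE addsmxSl; apply: contra EX'a.
rewrite col_mx_sub => /andP[_ /submxP[D ->]].
by rewrite -mulmxA Ea0 mulmx0.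
Qed.

(** [Q] compresses to a space that contains all [b(X) v] with [b] of length at most [d]; their
    number bounds its dimension. *)
Lemma compressed_pair n (X : mxtuple R g n) v :
  in_variety p X v -> row_full (E X v) ->
  exists r (Y : mxtuple R g r) u,
    [/\ (r <= nwords g d)%N, in_variety p Y u & row_full (E Y u)].
Proof.
move=> [sX pX] fullE; have [r [Q [rN QQ EQ]]] := orthonormal_rows (E X v)^T.
have QE : Q^T *m Q *m E X v = E X v.
  case/submxP: EQ => D ED; apply: trmx_inj.
  by rewrite !trmx_mul trmxK ED -!mulmxA [Q *m (_ *m _)]mulmxA QQ mul1mx.
have Qe w : (size w <= d)%N -> Q^T *m (Q *m (evw X w *m v)) = evw X w *m v.
  move=> wd; have -> : evw X w *m v = wcol (E X v) w by rewrite wcol_wmx.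
  by rewrite mulmxA /wcol colE mulmxA QE.
pose Y : mxtuple R g r := [ffun j => Q *m X j *m Q^T].
(* Length [d.+1] is allowed, since the outermost letter still acts on a vector of the space; this
   covers all words of [p]. *)
have evY w : (size w <= d.+1)%N -> evw Y w *m (Q *m v) = Q *m (evw X w *m v).
  elim: w => [|j w IHw] wd; first by rewrite !evw_nil !mul1mx.
  rewrite !evw_cons -!mulmxA IHw; last exact: ltnW.
  by rewrite ffunE -!mulmxA Qe.
exists r, Y, (Q *m v); split=> //.
  split=> [j|]; first by rewrite ffunE !trmx_mul trmxK sX mulmxA.
  transitivity (Q *m (nceval p X *m v)); last by rewrite pX mulmx0.
  rewrite !ncevalE !mulmx_suml mulmx_sumr; apply: eq_big_seq => w wp.
  by rewrite -!scalemxAl -scalemxAr evY // -dp size_le_ncdeg.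
have -> : E Y (Q *m v) = Q *m E X v.
  apply: wcol_inj => w wd; rewrite wcol_wmx // evY; last exact: leqW.
  by rewrite /wcol colE -mulmxA -colE -/(wcol _ _) wcol_wmx.
rewrite /row_full eqn_leq rank_leq_col -{1}(eqP fullE) -{1}QE -mulmxA.
exact: mxrankM_maxr.
Qed.

Lemma generic_pair_size n : min_degree_defining p -> (nwords g d <= n)%N ->
  exists (X : mxtuple R g n) v, in_variety p X v /\ row_full (E X v).
Proof.
move=> minp Nn; have [n0 [X0 [v0 [pX0 fX0]]]] := generic_pair minp.
have [r [X [v [rN pX fX]]]] := compressed_pair pX0 fX0.
have rn := leq_trans rN Nn; rewrite -(subnKC rn).
(* The padding stays in the variety even if [p] has a constant term, since the vector is extended by
   0 as well. *)
exists (dsum X 0), (col_mx v 0); split.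
  apply: in_variety_dsum => //; split=> [j|]; last by rewrite mulmx0.
  by rewrite ffunE trmx0.
rewrite /E wmx_evw_dsum -sub1mx (submx_trans _ (_ : (E X v <= _)%MS)) ?sub1mx //.
by rewrite -addsmxE addsmxSl.
Qed.

End GenericPairs.

(** * The limit and the ceiling *)

Section CurvatureSignature.
Variables (R : realType) (g : nat) (s : bool) (p : ncpoly R g) (m : nat).
Hypothesis curv_dim_max : forall n (X : mxtuple R g n) v,
  in_variety p X v -> (curv_dim s p X v <= n * m)%N.

Lemma curv_ratio_le n (X : mxtuple R g n) v : (0 < n)%N ->
  in_variety p X v -> (curv_dim s p X v)%:R / n%:R <= m%:R :> R.
Proof.
move=> n0 pX; rewrite ler_pdivrMr ?ltr0n // mulrC -natrM ler_nat.
exact: curv_dim_max.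
Qed.

Lemma curv_sup_bounds n (X : mxtuple R g n) v K : (0 < n)%N ->
  in_variety p X v -> (n * m - K <= curv_dim s p X v)%N ->
  m%:R - K%:R / n%:R <= curv_sup s p n <= m%:R.
Proof.
move=> n0 pX mK; rewrite /curv_sup; set A := (X in sup X).
have Aub : ubound A m%:R by move=> r [Y [u [pY ->]]]; exact: curv_ratio_le.
have AX : A ((curv_dim s p X v)%:R / n%:R) by exists X, v.
apply/andP; split; last by apply: ge_sup Aub; eexists; exact: AX.
have Abd : has_ubound A by exists m%:R.
apply: le_trans (ub_le_sup Abd AX).
rewrite ler_pdivlMr ?ltr0n // mulrBl divfK ?pnatr_eq0 -?lt0n //.
by rewrite lerBlDr -natrM -natrD ler_nat mulnC addnC -leq_subLR.
Qed.

Lemma curvature_signatureE N K :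
  (forall n, (0 < n)%N -> (N <= n)%N -> exists (X : mxtuple R g n) v,
     in_variety p X v /\ (n * m - K <= curv_dim s p X v)%N) ->
  curvature_signature s p = m%:R.
Proof.
move=> good; apply/cvg_lim => //; apply/cvgrPdist_le => e e0; near=> n.
have n0 : (0 < n)%N by near: n; exact: nbhs_infty_ge.
have Nn : (N <= n)%N by near: n; exact: nbhs_infty_ge.
have [X [v [pX mK]]] := good n n0 Nn.
have /andP[lo hi] := curv_sup_bounds n0 pX mK.
rewrite ger0_norm ?subr_ge0 // lerBlDr -lerBlDl (le_trans _ lo) // lerB //.
rewrite ler_pdivrMr ?ltr0n // mulrC -ler_pdivrMr //.
by near: n; exact: nbhs_infty_ger.
Unshelve. all: by end_near.
Qed.

(** [K < n] puts [n * m - K] above [n * (m - 1)], so the ratio lies strictly above [m - 1] and is at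
    most [m]. *)
Lemma ceil_curv_ratio n (X : mxtuple R g n) v K : (K < n)%N ->
  in_variety p X v -> (n * m - K <= curv_dim s p X v)%N ->
  Num.ceil ((curv_dim s p X v)%:R / n%:R : R) = m%:Z.
Proof.
move=> Kn pX mK; have n0 : (0 < n)%N by exact: leq_ltn_trans Kn.
apply: ceil_def; rewrite curv_ratio_le // andbT.
rewrite ltr_pdivlMr ?ltr0n // intrB mulrBl mul1r ltrBlDr -natrM -natrD ltr_nat.
by rewrite mulnC; lia.
Qed.

End CurvatureSignature.

Theorem proposition1p5 (R : realType) (g d : nat) :
  (0 < g)%N -> (0 < d)%N ->
  exists N : nat, forall p : ncpoly R g,
    ncsymmetric p -> ncdeg p = d -> min_degree_defining p ->
    forall n : nat, (0 < n)%N -> (N <= n)%N ->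
    exists (X : mxtuple R g n) (v : 'cV[R]_n),
      in_variety p X v /\
      forall s : bool,
        curvature_signature s p =
          (Num.ceil ((curv_dim s p X v)%:R / n%:R : R))%:~R.
Proof.
case: d => // d _ _; pose K := (nwords g d.+1 * nwords g d)%N.
(* The bound [K < n] serves the ceiling and [nwords g d <= n] the existence of a generic pair;
   neither depends on [p]. *)
exists (maxn K.+1 (nwords g d)) => p sp dp minp n n0.
rewrite geq_max => /andP[Kn Nn].
have bounds s : exists m,
    (forall k (X : mxtuple R g k) v, in_variety p X v ->
       (curv_dim s p X v <= k * m)%N) /\
    (forall k (X : mxtuple R g k) v, in_variety p X v ->
       row_full (wmx d (fun b => evw X b *m v)) ->
       (k * m - K <= curv_dim s p X v)%N).
  have sM : (signed_middle_mx d.+1 s p)^T = signed_middle_mx d.+1 s p.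
    by rewrite linearZ /= middle_mx_sym.
  have [m [W [posW maxW]]] := maximal_positive_rows sM.
  exists m; split=> k X v [sX pX]; first by apply: curv_dim_le maxW; rewrite ?dp.
  case/row_fullP => F FE; apply: (@curv_dim_ge _ _ _ _ _ _ _ _ _ W F^T) => //.
  by rewrite trmxK.
(* The pair is chosen before the sign, so the same one serves both signatures. *)
have [X [v [pX fX]]] := generic_pair_size dp minp Nn.
exists X, v; split=> // s; have [m [le_m ge_m]] := bounds s.
rewrite (ceil_curv_ratio le_m Kn pX) ?ge_m //.
apply: (@curvature_signatureE _ _ _ _ _ le_m (nwords g d) K) => k _ Nk.
have [Y [u [pY fY]]] := generic_pair_size dp minp Nk.
by exists Y, u; split=> //; exact: ge_m.
Qed.
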